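(* For a finite simple graph $G$ the following statements are equivalent: (1) $G$ admits a $\{{}^rP_3,{}^bP_3,{}^{rrb}K_3\}$-free $2$-edge-colouring. (2) $G$ admits a $\{{}^rP_3,{}^bP_3,{}^{rbb}K_3\}$-free $2$-edge-colouring. (3) $G$ is a skew-augmentation of the line graph of a bipartite multigraph.
   Context: Graphs are finite and simple unless called multigraphs (which may have parallel edges, no loops). A $2$-edge-colouring of $G$ assigns to every edge the colour red or blue (not necessarily properly). For a set $\mathcal F$ of $2$-edge-coloured graphs, a $2$-edge-colouring of $G$ is $\mathcal F$-free if no induced $2$-edge-coloured subgraph is isomorphic (preserving colours) to a member of $\mathcal F$. Patterns on three vertices: ${}^rP_3$ (resp. ${}^bP_3$) is the path on three vertices with both edges red (resp. blue); ${}^{rrb}K_3$ is the triangle with two red and one blue edge; ${}^{rbb}K_3$ is the triangle with one red and two blue edges. The line graph of a multigraph $H$ is the simple graph with vertex set $E(H)$, two distinct edges being adjacent iff they share at least one endpoint (so parallel edges are adjacent). Augmentations: an edge of a graph is flat if it lies in no triangle. Let $xy$ be a flat edge of a graph $G_0$ and let $B=(A,C)$ be a co-bipartite graph disjoint from $G_0$ whose vertex set is partitioned into cliques $A$ and $C$, with at least one edge between $A$ and $C$. Augmenting $G_0$ along $xy$ with augment $B$ means taking the disjoint union of $G_0-\{x,y\}$ and $B$ and adding all edges between $A$ and $N(x)\setminus\{y\}$ and all edges between $C$ and $N(y)\setminus\{x\}$. An augmentation of $G_0$ is a graph obtained by choosing a (possibly empty) matching $x_1y_1,\dots,x_ky_k$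 of flat edges of $G_0$ and co-bipartite graphs $B_i=(A_i,C_i)$ with at least one $A_iC_i$-edge, and augmenting each $x_iy_i$ with augment $B_i$ (the order is irrelevant). If $G_0$ is the line graph of a bipartite multigraph $H(X,Y)$ and the matching is $e_1f_1,\dots,e_kf_k$ (so the $e_i,f_i$ are edges of $H$), the augmentation is an $X$-augmentation (resp. $Y$-augmentation) if for each $i$ there is a vertex of $X$ (resp. of $Y$) incident in $H$ with both $e_i$ and $f_i$; it is a skew-augmentation if it is an $X$-augmentation or a $Y$-augmentation. *)

(* Defs.v *)
From HB Require Import structures.
From mathcomp Require Import all_boot.

Set Implicit Arguments.
Unset Strict Implicit.
Unset Printing Implicit Defensive.

Record sgraph := SGraph {
  svertex :> finType;
  adj : rel svertex;
  adj_sym : symmetric adj;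
  adj_irr : irreflexive adj }.

Definition sgraph_iso (G H : sgraph) : Prop :=
  exists f : G -> H,
    bijective f /\ (forall u v : G, adj (f u) (f v) = adj u v).

Definition flat_edge (G : sgraph) (x y : G) : Prop :=
  adj x y /\ (forall z : G, ~~ (adj x z && adj y z)).

Section Induced.
Variables (G : sgraph) (S : {set G}).

Definition induced_adj : rel {x : G | x \in S} :=
  fun u v => adj (val u) (val v).

Fact induced_sym : symmetric induced_adj.
Proof. by move=> u v; rewrite /induced_adj adj_sym. Qed.

Fact induced_irr : irreflexive induced_adj.
Proof. by move=> u; rewrite /induced_adj adj_irr. Qed.

Definition induced : sgraph := SGraph induced_sym induced_irr.

End Induced.

Variant colour := Red | Blue.

(* A colouring of the edges is a symmetric function on pairs of vertices; the
   values on pairs of non-adjacent vertices are junk and are never consulted. *)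
Record ecolouring (G : sgraph) := EColouring {
  ecol :> G -> G -> colour;
  ecol_sym : forall u v : G, ecol u v = ecol v u }.

Record ecgraph := ECGraph {
  ecg_graph :> sgraph;
  ecg_col : ecolouring ecg_graph }.

Definition ecgraph_iso (G H : ecgraph) : Prop :=
  exists f : G -> H,
    [/\ bijective f,
        forall u v : G, adj (f u) (f v) = adj u v
      & forall u v : G, adj u v -> ecg_col H (f u) (f v) = ecg_col G u v].

Section InducedColoured.
Variables (G : ecgraph) (S : {set G}).

Definition induced_col (u v : induced S) : colour :=
  ecg_col G (val u) (val v).

Fact induced_col_sym (u v : induced S) : induced_col u v = induced_col v u.
Proof. exact: ecol_sym. Qed.

Definition ec_induced : ecgraph := ECGraph (EColouring induced_col_sym).

End InducedColoured.

Definition ec_free (F : ecgraph -> Prop) (G : ecgraph) : Prop :=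
  forall (S : {set G}) (P : ecgraph), F P -> ~ ecgraph_iso (ec_induced S) P.

Definition P3_adj : rel 'I_3 := fun i j => (i.+1 == j) || (j.+1 == i).

Fact P3_sym : symmetric P3_adj.
Proof. by move=> i j; rewrite /P3_adj orbC. Qed.

Fact P3_irr : irreflexive P3_adj.
Proof. by move=> i; rewrite /P3_adj orbb eqn_leq ltnn. Qed.

Definition P3 : sgraph := SGraph P3_sym P3_irr.

Definition K3_adj : rel 'I_3 := fun i j => i != j.

Fact K3_sym : symmetric K3_adj.
Proof. by move=> i j; rewrite /K3_adj eq_sym. Qed.

Fact K3_irr : irreflexive K3_adj.
Proof. by move=> i; rewrite /K3_adj eqxx. Qed.

Definition K3 : sgraph := SGraph K3_sym K3_irr.

Definition mono_P3 (c : colour) : ecgraph :=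
  @ECGraph P3 (EColouring (fun _ _ : P3 => erefl c)).

(* The two edges at vertex 2 have colour c, the edge 01 has colour d. *)
Definition K3_col (c d : colour) (i j : K3) : colour :=
  if (i == ord_max :> 'I_3) || (j == ord_max :> 'I_3) then c else d.

Fact K3_col_sym (c d : colour) (i j : K3) : K3_col c d i j = K3_col c d j i.
Proof. by rewrite /K3_col orbC. Qed.

Definition two_one_K3 (c d : colour) : ecgraph :=
  @ECGraph K3 (EColouring (K3_col_sym c d)).

Definition rP3 : ecgraph := mono_P3 Red.
Definition bP3 : ecgraph := mono_P3 Blue.
Definition rrbK3 : ecgraph := two_one_K3 Red Blue.
Definition rbbK3 : ecgraph := two_one_K3 Blue Red.

Definition admits_free (F : ecgraph -> Prop) (G : sgraph) : Prop :=
  exists c : ecolouring G, ec_free F (ECGraph c).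

Record multigraph := Multigraph {
  mvertex : finType;
  medge : finType;
  mends : medge -> {set mvertex};
  mends_card : forall e : medge, #|mends e| = 2 }.

Definition bipartition (H : multigraph) (X Y : {set mvertex H}) : Prop :=
  [/\ X :|: Y = setT,
      [disjoint X & Y]
    & forall e : medge H,
        #|mends e :&: X| = 1 /\ #|mends e :&: Y| = 1].

Section LineGraph.
Variable H : multigraph.

Definition line_adj : rel (medge H) :=
  fun e f => (e != f) && (mends e :&: mends f != set0).

Fact line_sym : symmetric line_adj.
Proof. by move=> e f; rewrite /line_adj eq_sym setIC. Qed.

Fact line_irr : irreflexive line_adj.
Proof. by move=> e; rewrite /line_adj eqxx. Qed.

Definition line_graph : sgraph := SGraph line_sym line_irr.

End LineGraph.

Definition clique (G : sgraph) (S : {set G}) : Prop :=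
  {in S &, forall u v, u != v -> adj u v}.

Record augment := Augment {
  aug_graph :> sgraph;
  augA : {set aug_graph};
  augC : {set aug_graph};
  augAC_cover : augA :|: augC = setT;
  augAC_disjoint : [disjoint augA & augC];
  augA_clique : clique augA;
  augC_clique : clique augC;
  augAC_edge : exists a c, [/\ a \in augA, c \in augC & adj a c] }.

Record augmentation_data (G0 : sgraph) := AugmentationData {
  aug_num : nat;
  aug_x : 'I_aug_num -> G0;
  aug_y : 'I_aug_num -> G0;
  aug_flat : forall i, flat_edge (aug_x i) (aug_y i);
  aug_matching : forall i j, i != j ->
    [disjoint [set aug_x i; aug_y i] & [set aug_x j; aug_y j]];
  aug_B : 'I_aug_num -> augment }.

Arguments aug_x {G0} D i : rename.
Arguments aug_y {G0} D i : rename.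
Arguments aug_B {G0} D i : rename.

Section Augmentation.
Variables (G0 : sgraph) (D : augmentation_data G0).

Definition aug_matched : {set G0} :=
  [set z | [exists i, (z == aug_x D i) || (z == aug_y D i)]].

Definition aug_block : finType := {i : 'I_(aug_num D) & aug_B D i}.

Definition aug_vertex : finType :=
  ({z : G0 | z \notin aug_matched} + aug_block)%type.

Definition aug_origin (p : aug_block) : G0 :=
  if tagged p \in augA (aug_B D (tag p)) then aug_x D (tag p)
  else aug_y D (tag p).

(* All the x_i y_i are augmented at once.  Augmenting them one after the other
   gives the same graph: each step replaces x_i by A_i and y_i by C_i in every
   outside neighbourhood, so two vertices in distinct blocks are adjacent
   exactly when the vertices that they replace are adjacent in G0. *)
Definition aug_adj : rel aug_vertex := fun u v =>
  match u, v with
  | inl a, inl b => adj (val a) (val b)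
  | inl a, inr q => adj (val a) (aug_origin q)
  | inr p, inl b => adj (aug_origin p) (val b)
  | inr p, inr q =>
      if tag p == tag q then adj (tagged p) (tagged_as p q)
      else adj (aug_origin p) (aug_origin q)
  end.

Fact aug_sym : symmetric aug_adj.
Proof.
move=> [a|p] [b|q]; [exact: adj_sym | exact: adj_sym | exact: adj_sym |].
rewrite /aug_adj [tag q == tag p]eq_sym.
case: eqP => [|_]; last exact: adj_sym.
case: p q => [i a] [j b] /= eqij; move: b; rewrite -eqij => b.
by rewrite !tagged_asE; exact: adj_sym.
Qed.

Fact aug_irr : irreflexive aug_adj.
Proof.
case=> [a|[i a]]; first exact: adj_irr.
by rewrite /aug_adj eqxx tagged_asE; exact: adj_irr.
Qed.

Definition augmented : sgraph := SGraph aug_sym aug_irr.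

End Augmentation.

(* D is an S-augmentation, for a side S of the bipartition of H. *)
Definition side_augmentation (H : multigraph) (S : {set mvertex H})
    (D : augmentation_data (line_graph H)) : Prop :=
  forall i, exists v : mvertex H,
    [/\ v \in S, v \in @mends H (aug_x D i) & v \in @mends H (aug_y D i)].

Definition skew_augmentation (H : multigraph) (X Y : {set mvertex H})
    (G : sgraph) : Prop :=
  exists D : augmentation_data (line_graph H),
    (side_augmentation X D \/ side_augmentation Y D)
    /\ sgraph_iso G (augmented D).

(* Main.v *)
(* In a colouring as in (1) or (2), the colour occurring twice in the forbidden
   triangle is, together with equality, an equivalence relation whose classes
   are cliques; call the edges of the other colour red. Consecutive red edges
   u v, v w force u and w to be equal or adjacent. Conversely such an
   equivalence relation gives a colouring as in (1) and, exchanging the colours,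
   one as in (2).

   A red component is a clique if it contains a red triangle, and otherwise lies
   within two classes. Take as vertices of H the red components (one side) and
   the classes (other side), each vertex of G being an edge of H; the components
   that are not cliques are shrunk to one red edge, which is flat, and are
   recovered by an augmentation.

   In the other direction, two vertices of the augmentation are equivalent if
   the edges of H they come from have the same end on the side opposite to that
   of the augmentation. *)
Require Import Defs.
From mathcomp Require Import all_boot.

Set Implicit Arguments.
Unset Strict Implicit.
Unset Printing Implicit Defensive.

(** * Coloured patterns as embeddings *)

Lemma inj_surj_bij (T U : finType) (g : T -> U) :
  injective g -> (forall v, exists u, g u = v) -> bijective g.
Proof.
move=> g_inj g_surj.
have g_ex v : exists u, g u == v by have [u <-] := g_surj v; exists u.
exists (fun v => xchoose (g_ex v)) => v; last exact/eqP/(xchooseP (g_ex v)).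
exact/g_inj/eqP/(xchooseP (g_ex (g v))).
Qed.

Definition ec_embedding (P G : ecgraph) (h : P -> G) : Prop :=
  [/\ injective h, forall i j, adj (h i) (h j) = adj i j
    & forall i j, adj i j -> ecg_col G (h i) (h j) = ecg_col P i j].

(** The set [S] is recovered as the image of [h], and the isomorphism as the inverse of [h] onto
    that image. *)
Lemma ec_freeP (F : ecgraph -> Prop) (G : ecgraph) :
  ec_free F G <-> forall P, F P -> ~ exists h : P -> G, ec_embedding h.
Proof.
split=> [Gfree P FP [h [h_inj h_adj h_col]] | Gfree S P FP].
  apply: (Gfree [set h i | i : P] P FP).
  have hP i : h i \in [set h i | i : P] by exact: imset_f.
  pose g i : ec_induced [set h i | i : P] := exist _ (h i) (hP i).
  have [||f gK fK] := @inj_surj_bij P (ec_induced [set h i | i : P]) g.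
  - by move=> i j [/h_inj].
  - by case=> x /[dup] /imsetP[i _ ->] hi; exists i; apply: val_inj.
  exists f; split=> [|u v|u v uv]; first by exists g.
    by rewrite -[in RHS](fK u) -[in RHS](fK v) -h_adj.
  rewrite -[in RHS](fK u) -[in RHS](fK v); apply/esym/h_col.
  by rewrite -h_adj; move: uv; rewrite -[in X in X -> _](fK u) -[in X in X -> _](fK v).
case=> f [[g fK gK] f_adj f_col]; apply: (Gfree P FP).
exists (fun i => val (g i)); split=> [i j /val_inj/(can_inj gK) // | i j | i j ij].
  by rewrite -{2}(gK i) -{2}(gK j) f_adj.
by rewrite -{2}(gK i) -{2}(gK j) f_col // -f_adj !gK.
Qed.

(** * Colourings and clique splittings *)

Definition triple (T : Type) (u v w : T) (i : 'I_3) : T := nth u [:: u; v; w] i.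

Lemma ord3P (P : 'I_3 -> Prop) :
  P ord0 -> P (Ordinal (isT : 1 < 3)) -> P ord_max -> forall i, P i.
Proof.
by move=> P0 P1 P2 [[|[|[|//]]] lti3];
  [move: P0|move: P1|move: P2]; congr P; apply: val_inj.
Qed.

(* [b] is equality or adjacency by an edge of the colour that occurs twice in
   the forbidden triangle, and [crossing b] is the other colour. *)
Definition crossing (G : sgraph) (b : rel G) : rel G :=
  fun u v => adj u v && ~~ b u v.

Definition clique_splitting (G : sgraph) (b : rel G) : Prop :=
  [/\ reflexive b, symmetric b, transitive b,
      forall u v, b u v -> u != v -> adj u v
    & forall u v w, crossing b u v -> crossing b v w -> u != w -> adj u w].

Definition eqcol (c d : colour) : bool :=
  match c, d with Red, Red | Blue, Blue => true | _, _ => false end.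

Lemma eqcolP c d : reflect (c = d) (eqcol c d).
Proof. by case: c; case: d; constructor. Qed.

(** Without the two monochromatic paths, consecutive edges of one colour close up to a triangle;
    without the mixed triangle, the closing edge of two [c]-edges has colour [c], which is
    transitivity. Colours are absent from the right-hand side, so exchanging [c] and [d] gives an
    equivalent condition. *)
Lemma admits_freeP (G : sgraph) (c d : colour) : c <> d ->
  admits_free (fun P => [\/ P = rP3, P = bP3 | P = two_one_K3 c d]) G <->
  exists b : rel G, clique_splitting b.
Proof.
move=> neq_cd; split=> [[k /ec_freeP kfree] | [b [b_refl b_sym b_trans b_adj x_adj]]].
  have k_P3 u v w : adj u v -> adj v w -> k u v = k v w -> u != w -> adj u w.
    move=> uv vw eqk uw; apply: contraT => nuw.
    have FP : [\/ mono_P3 (k u v) = rP3, mono_P3 (k u v) = bP3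
                | mono_P3 (k u v) = two_one_K3 c d].
      by case: (k u v); [constructor 1 | constructor 2].
    case: (kfree _ FP); exists (triple u v w); split.
    - have uv' : u != v by apply: contraTneq uv => ->; rewrite adj_irr.
      have vw' : v != w by apply: contraTneq vw => ->; rewrite adj_irr.
      elim/ord3P; elim/ord3P=> //= /eqP; rewrite /triple /=;
        rewrite ?(negPf uv', negPf uw, negPf vw') //;
        by rewrite eq_sym ?(negPf uv', negPf uw, negPf vw').
    - by elim/ord3P; elim/ord3P; rewrite /triple /= ?adj_irr ?uv ?vw ?(negPf nuw) //
        adj_sym ?uv ?vw ?(negPf nuw).
    - by elim/ord3P; elim/ord3P; rewrite /triple //= ecol_sym.
  have k_K3 u v w : adj u v -> adj v w -> k u v = c -> k v w = c -> adj u w ->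
      k u w = c.
    move=> uv vw kuv kvw uw.
    case: (eqcolP (k u w) c) => // /eqcolP kuw.
    have {}kuw : k u w = d by move: kuw neq_cd; case: (k u w); case: (c); case: (d).
    have FP : [\/ two_one_K3 c d = rP3, two_one_K3 c d = bP3
                | two_one_K3 c d = two_one_K3 c d] by constructor 3.
    (* [v] comes last because the two [c]-coloured edges of the pattern meet at its vertex 2. *)
    case: (kfree _ FP); exists (triple u w v); split.
    - have uv' : u != v by apply: contraTneq uv => ->; rewrite adj_irr.
      have vw' : v != w by apply: contraTneq vw => ->; rewrite adj_irr.
      have uw' : u != w by apply: contraTneq uw => ->; rewrite adj_irr.
      elim/ord3P; elim/ord3P=> //= /eqP; rewrite /triple /=;
        rewrite ?(negPf uv', negPf uw', negPf vw') //;
        by rewrite eq_sym ?(negPf uv', negPf uw', negPf vw').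
    - by elim/ord3P; elim/ord3P; rewrite /triple /= ?adj_irr ?uv ?vw ?uw //
        adj_sym ?uv ?vw ?uw.
    - by elim/ord3P; elim/ord3P; rewrite /triple //= ecol_sym.
  pose b u v := (u == v) || adj u v && eqcol (k u v) c.
  have b_sym u v : b u v = b v u by rewrite /b eq_sym adj_sym ecol_sym.
  have b_trans v u w : b u v -> b v w -> b u w.
    rewrite /b => /predU1P[->|/andP[uv /eqcolP kuv]] //.
    move=> /predU1P[<-|/andP[vw /eqcolP kvw]].
      by rewrite uv; case: eqcolP => //; rewrite orbT.
    case: eqP => //= /eqP uw; have auw := k_P3 u v w uv vw (etrans kuv (esym kvw)) uw.
    by rewrite auw; apply/eqcolP/(k_K3 u v w).
  exists b; split=> // [x | u v | u v w].
  - by rewrite /b eqxx.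
  - by rewrite /b => /predU1P[->|/andP[]]; rewrite ?eqxx.
  rewrite /crossing /b !negb_or => /andP[uv /andP[_]]; rewrite uv => kuv.
  case/andP=> vw /andP[_]; rewrite vw => kvw; apply: k_P3 uv vw _.
  by move: kuv kvw; case: (c); case: (k u v); case: (k v w).
pose k u v := if b u v then c else d.
have k_sym u v : k u v = k v u by rewrite /k b_sym.
exists (EColouring k_sym); apply/ec_freeP => P FP [h [h_inj h_adj h_col]].
have kc u v : k u v = c -> b u v by rewrite /k; case: ifP => // _ /esym/neq_cd.
have kd u v : k u v = d -> ~~ b u v by rewrite /k; case: ifP.
have no_P3 e : P <> mono_P3 e.
  move=> defP; case: _ / (esym defP) h h_inj h_adj h_col {FP} => h h_inj h_adj h_col.
  pose i1 : P3 := Ordinal (isT : 1 < 3).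
  have h01 := h_adj (ord0 : 'I_3) i1; have h12 := h_adj i1 (ord_max : 'I_3).
  have h02 : ~~ adj (h (ord0 : 'I_3)) (h (ord_max : 'I_3)) by rewrite h_adj.
  have c01 := h_col (ord0 : 'I_3) i1 isT; have c12 := h_col i1 (ord_max : 'I_3) isT.
  have n02 : h (ord0 : 'I_3) != h (ord_max : 'I_3) by apply/eqP => /h_inj.
  case/negP: h02; move: c01 c12; rewrite /= => c01 c12.
  case: (eqcolP e c) => [ec | /eqcolP ec].
    by apply: b_adj => //; apply: (b_trans (h i1)); apply: kc; rewrite ?c01 ?c12.
  have ed : e = d by move: ec neq_cd; case: (e); case: (c); case: (d).
  by apply: (x_adj _ (h i1)) n02; rewrite /crossing ?h01 ?h12 kd ?c01 ?c12.
case: FP => [/no_P3 // | /no_P3 // | defP].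
case: _ / (esym defP) h h_inj h_adj h_col {no_P3} => h h_inj h_adj h_col.
pose i1 : K3 := Ordinal (isT : 1 < 3).
have c01 := h_col (ord0 : 'I_3) i1 isT; have c12 := h_col i1 (ord_max : 'I_3) isT.
have c02 := h_col (ord0 : 'I_3) (ord_max : 'I_3) isT.
move: c01 c12 c02 => /= /kd /negP n01 /kc b12 /kc b02.
by apply/n01/(b_trans _ _ _ b02); rewrite b_sym.
Qed.

(** * Red components of a clique splitting *)

Section Decomposition.
Variables (G : sgraph) (b : rel G).
Hypothesis b_split : clique_splitting b.

Let red : rel G := crossing b.
(** Adjacency made reflexive, since [b] is reflexive; chains of edges can then be composed without
    asking whether their ends coincide. *)
Let near (u v : G) := red u v || b u v.

Let b_refl : reflexive b. Proof. by case: b_split. Qed.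
Let b_sym : symmetric b. Proof. by case: b_split. Qed.
Let b_trans : transitive b. Proof. by case: b_split. Qed.

Let red_sym : symmetric red.
Proof. by move=> u v; rewrite /red /crossing adj_sym b_sym. Qed.

Let adj_near u v : adj u v = (u != v) && near u v.
Proof.
rewrite /near /red /crossing; case: b_split => _ _ _ b_adj _.
case: eqP => [-> | /eqP uv]; first by rewrite adj_irr.
by case: (boolP (b u v)) => [/b_adj -> // | _]; rewrite andbT orbF.
Qed.

Let red_near v u w : red v u -> red v w -> near u w.
Proof.
rewrite red_sym => vu vw; case: (eqVneq u w) => [-> | uw].
  by rewrite /near b_refl orbT.
have [_ _ _ _ /(_ u v w vu vw uw)] := b_split.
by rewrite adj_near uw.
Qed.

Let red_b u v : red u v -> b u v = false.
Proof. by case/andP=> _ /negPf. Qed.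

(** Were [w] in the classes of both [x] and [y], these would be one class, against the red edge. *)
Let near_red x y w : red x y -> near w x -> near w y -> red w x || red w y.
Proof.
move=> xy /orP[-> // | wx] /orP[-> | wy]; first by rewrite orbT.
have : b x y by apply: b_trans wy; rewrite b_sym.
by rewrite red_b.
Qed.

Let near_triangle a c d v := [&& near v a, near v c & near v d].

(** By [near_red], [v] is red to at least two of the three vertices. Through [v], [w] is near these
    two, hence red to one of them, and through that one it is near the third. *)
Let near_triangle_step a c d v w :
    red a c -> red a d -> red c d -> red v w -> near_triangle a c d v ->
  near_triangle a c d w.
Proof.
have step x y z : red x y -> red x z -> red y z -> red v x -> red v y ->
    red v w -> [&& near w x, near w y & near w z].
  move=> xy xz yz vx vy vw; rewrite (red_near vw vx) (red_near vw vy) /=.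
  have /orP[] := near_red xy (red_near vw vx) (red_near vw vy).
    by rewrite red_sym => xw; apply: red_near xw xz.
  by rewrite red_sym => yw; apply: red_near yw yz.
move=> ac ad cd vw /and3P[va vc vd].
have [dc ca da] : [/\ red d c, red c a & red d a] by split; rewrite red_sym.
have := near_red ac va vc; have := near_red ad va vd; have := near_red cd vc vd.
move=> /orP[]? /orP[]? /orP[]?;
  first [ have /and3P[wa wc wd] : near_triangle a c d w by exact: (step a c d)
        | have /and3P[wa wd wc] : near_triangle a d c w by exact: (step a d c)
        | have /and3P[wc wd wa] : near_triangle c d a w by exact: (step c d a) ];
  exact/and3P.
Qed.

Definition comp (v : G) : {set G} := [set w | connect red v w].

Let red_csym : connect_sym red := sym_connect_sym red_sym.

Let comp_refl v : v \in comp v.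
Proof. by rewrite inE connect0. Qed.

Let compP u v : reflect (comp u = comp v) (u \in comp v).
Proof.
apply: (iffP idP) => [|<-]; rewrite ?comp_refl // inE => uv.
by apply/setP => w; rewrite !inE (same_connect red_csym uv).
Qed.

Let comp_red u v : red u v -> comp u = comp v.
Proof. by move=> uv; apply/compP; rewrite inE red_csym connect1. Qed.

Let connect_ind (P : G -> Prop) v :
  P v -> (forall u w, connect red v u -> red u w -> P u -> P w) ->
  forall w, connect red v w -> P w.
Proof.
move=> Pv step w /connectP[p]; elim/last_ind: p w => [|p x IHp] w /=.
  by move=> _ ->.
rewrite rcons_path last_rcons => /andP[vp px] ->; apply: step px (IHp _ vp _) => //.
by apply/connectP; exists p.
Qed.

(** Such a pair is the flat edge to which the component will shrink; the classes of its ends cut the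
    component into the two cliques of an augment. *)
Definition spans (C : {set G}) (p : G * G) : bool :=
  [&& p.1 \in C, red p.1 p.2 & [forall z in C, b z p.1 || b z p.2]].

(* If the component has a red triangle then, along red paths, all its vertices
   are near that triangle, hence two of them have a common red neighbour on it.
   Otherwise all red neighbours of a vertex are in the same class, and the
   component only has the two classes of the ends of any of its red edges. *)
Let comp_cases v :
  {in comp v &, forall u w, near u w} \/ exists p, spans (comp v) p.
Proof.
case: (boolP [exists t : G * G * G, [&& t.1.1 \in comp v, red t.1.1 t.1.2,
    red t.1.1 t.2 & red t.1.2 t.2]]) => [/existsP[[[a c] d]] /= | noT].
  case/and4P=> /compP <- ac ad cd; left.
  have nearT : forall u, connect red a u -> near_triangle a c d u.
    apply: connect_ind => [|u w _ uw]; last exact: near_triangle_step.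
    by rewrite /near_triangle /near b_refl ac ad !orbT.
  move=> u w; rewrite !inE => /nearT/and3P[ua uc ud] /nearT/and3P[wa wc wd].
  have := near_red ac ua uc; have := near_red ad ua ud; have := near_red cd uc ud.
  have := near_red ac wa wc; have := near_red ad wa wd; have := near_red cd wc wd.
  have via x : red u x -> red w x -> near u w.
    by rewrite red_sym [red w x]red_sym; exact: red_near.
  have {}via x : red w x -> red u x -> near u w by move=> wx /via; apply.
  by move=> /orP[]? /orP[]? /orP[]? /orP[]? /orP[]? /orP[]?;
    first [exact: (via a) | exact: (via c) | exact: (via d)].
have nbr u x y : u \in comp v -> red u x -> red u y -> b x y.
  move=> uv ux uy; case/orP: (red_near ux uy) => // xy.
  by case/existsP: noT; exists (u, x, y); rewrite /= uv ux uy xy.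
case: (pickP (red v)) => [y vy | nored]; last first.
  have comp1 : forall u, connect red v u -> u = v.
    apply: connect_ind => // u w _ uw eq_uv.
    by move: uw; rewrite eq_uv nored.
  by left=> u w; rewrite !inE => /comp1 -> /comp1 ->; rewrite /near b_refl orbT.
right; exists (v, y); rewrite /spans /= comp_refl vy; apply/forall_inP => z.
(* The invariant also keeps a red neighbour [x] of [z] in the opposite class: by [nbr], the next
   vertex of the path falls in the class of [x]. *)
rewrite inE => vz; suff : [exists x, red z x && (b z v && b x y || b z y && b x v)].
  by case/existsP=> x /andP[_ /orP[]/andP[-> _]]; rewrite ?orbT.
elim/connect_ind: z / vz => [|u w vu uw /existsP[x /andP[ux H]]].
  by apply/existsP; exists y; rewrite vy !b_refl.
apply/existsP; exists u; rewrite red_sym uw /=.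
have bxw : b w x by apply: (nbr u); rewrite ?inE.
by case/orP: H => /andP[-> bx] /=; rewrite (b_trans bxw bx) ?orbT.
Qed.


(** * The multigraph and its matching *)

Let class (v : G) : {set G} := [set w | b v w].

Let classP u v : (class u == class v) = b u v.
Proof.
apply/eqP/idP => [eq_uv | uv].
  by have := b_refl v; rewrite -[b v v]in_set -/(class v) -eq_uv inE.
apply/setP => w; rewrite !inE; apply/idP/idP; last exact: b_trans.
by apply: b_trans; rewrite b_sym.
Qed.

(** The choice depends on the set [C] alone, so all vertices of a component get the same pair. *)
Let spanning_pair (C : {set G}) : option (G * G) := [pick p | spans C p].

(** A clique that has a spanning pair, such as a single red edge, counts as false and is augmented
    too. *)
Let is_clique_comp v := spanning_pair (comp v) == None.

Let near_comp u v : is_clique_comp u -> comp u = comp v -> near u v.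
Proof.
move=> clq /esym/compP vu; have [nearC | [p pC]] := comp_cases u.
  by apply: nearC; rewrite ?comp_refl.
move: clq; rewrite /is_clique_comp /spanning_pair.
by case: pickP => // /(_ p); rewrite pC.
Qed.

Let pairs : {set G * G} := [set p | spanning_pair (comp p.1) == Some p].

Let pairsP p : p \in pairs ->
  red p.1 p.2 /\ forall z, z \in comp p.1 -> b z p.1 || b z p.2.
Proof.
rewrite inE /spanning_pair; case: pickP => // q /and3P[_ q12 /forall_inP qC] /eqP[eq_qp].
by rewrite -eq_qp in qC *.
Qed.

Let pairs_inj p q : p \in pairs -> q \in pairs -> comp p.1 = comp q.1 -> p = q.
Proof. by rewrite !inE => /eqP pP /eqP qP pq; move: pP; rewrite pq qP => -[]. Qed.

Let comp2 p : p \in pairs -> comp p.2 = comp p.1.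
Proof. by move=> /pairsP[/comp_red]. Qed.

Let pairs_not_clique p : p \in pairs -> is_clique_comp p.1 = false.
Proof. by rewrite inE /is_clique_comp => /eqP->. Qed.

Let pair_of v : is_clique_comp v = false -> exists2 p, p \in pairs & comp p.1 = comp v.
Proof.
rewrite /is_clique_comp; case def_p: (spanning_pair (comp v)) => [p|] // _.
have : spans (comp v) p.
  by move: def_p; rewrite /spanning_pair; case: pickP => // q ? [<-].
by case/and3P=> /compP pv _ _; exists p; rewrite // inE pv def_p.
Qed.

Let is_end v := [exists p in pairs, (v == p.1) || (v == p.2)].

(* Multigraph whose red-side vertices are the components, and the others the
   classes; a component that is not a clique is cut down to one red edge. *)
Let kept : finType := {v : G | is_clique_comp v || is_end v}.

(** The boolean separates a component from a class even when they are the same set of vertices; it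
    also names the side of the bipartition. *)
Let kept_ends (e : kept) : {set bool * {set G}} :=
  [set (true, comp (val e)); (false, class (val e))].

Fact kept_ends_card (e : kept) : #|kept_ends e| = 2.
Proof. by rewrite cards2. Qed.

Let H := Multigraph kept_ends_card.

Let H_adj (e f : line_graph H) :
  adj e f = (val (e : kept) != val (f : kept)) &&
    ((comp (val (e : kept)) == comp (val (f : kept)))
     || b (val (e : kept)) (val (f : kept))).
Proof.
rewrite /= /line_adj /= -(inj_eq val_inj) -classP; congr (_ && _).
apply/set0Pn/orP => [[x] | [/eqP ef | /eqP ef]].
- rewrite /kept_ends !inE => /andP[/orP[]/eqP->];
    rewrite !xpair_eqE /= ?orbF => ->; by [left | right].
- by exists (true, comp (val (e : kept))); rewrite !inE ef !eqxx.
- by exists (false, class (val (e : kept))); rewrite !inE ef !eqxx orbT.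
Qed.

Let P (i : 'I_#|pairs|) : G * G := enum_val i.

Let PP i : P i \in pairs. Proof. exact: enum_valP. Qed.

Let P1_kept i : is_clique_comp (P i).1 || is_end (P i).1.
Proof. by apply/orP; right; apply/exists_inP; exists (P i); rewrite ?PP ?eqxx. Qed.

Let P2_kept i : is_clique_comp (P i).2 || is_end (P i).2.
Proof. by apply/orP; right; apply/exists_inP; exists (P i); rewrite ?PP ?eqxx ?orbT. Qed.

Let Hx i : line_graph H := exist _ (P i).1 (P1_kept i) : kept.
Let Hy i : line_graph H := exist _ (P i).2 (P2_kept i) : kept.

Let kept_comp i (z : kept) : comp (val z) = comp (P i).1 ->
  (val z == (P i).1) || (val z == (P i).2).
Proof.
move=> zi; case/orP: (valP z) => [|/exists_inP[p pP zp]].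
  by rewrite /is_clique_comp zi -/(is_clique_comp _) pairs_not_clique ?PP.
rewrite -(pairs_inj pP (PP i)) // -zi.
by case/orP: zp => /eqP->; rewrite ?comp2.
Qed.

(** Only the two ends are kept in their component, so a common neighbour would share a class with
    each of them, which the red edge forbids. *)
Let H_flat i : flat_edge (Hx i) (Hy i).
Proof.
have [x_y _] := pairsP (PP i); split=> [|z].
  rewrite H_adj /= comp2 ?PP // eqxx andbT.
  by apply: contraTneq x_y => ->; rewrite /red /crossing adj_irr.
apply/negP => /andP[]; rewrite !H_adj /= => /andP[xz xz'] /andP[yz yz'].
have zi : comp (val (z : kept)) != comp (P i).1.
  apply: contraNneq xz => /kept_comp /orP[] /eqP eqz.
    by rewrite eqz eqxx.
  by rewrite -eqz eqxx in yz.
move: xz' yz'; rewrite comp2 ?PP // ![_ == comp (val _)]eq_sym (negPf zi) /= => bx by_.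
by have := red_b x_y; rewrite (b_trans bx) // b_sym.
Qed.

Let P_inj i j : comp (P i).1 = comp (P j).1 -> i = j.
Proof. by move=> /(pairs_inj (PP i) (PP j)) /enum_val_inj. Qed.

Let H_matching i j : i != j -> [disjoint [set Hx i; Hy i] & [set Hx j; Hy j]].
Proof.
move=> ij; apply/pred0P => z /=; apply: contraNF ij; rewrite !inE => zij.
have zc k : (z == Hx k) || (z == Hy k) -> comp (val (z : kept)) = comp (P k).1.
  by case/orP=> /eqP->; rewrite //= comp2 ?PP.
by case/andP: zij => /zc zi /zc zj; apply/eqP/P_inj; rewrite -zi.
Qed.

(** * The component of a pair as an augment *)

Section Block.
Variable i : 'I_#|pairs|.

Let blockG := induced (comp (P i).1).
Let blockA : {set blockG} := [set z | b (val z) (P i).1].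
Let blockC : {set blockG} := ~: blockA.

Let blockCP (z : blockG) : z \in blockC -> b (val z) (P i).2.
Proof.
by rewrite !inE => /negPf zx; have [_ /(_ _ (valP z))] := pairsP (PP i); rewrite zx.
Qed.

Fact block_cover : blockA :|: blockC = setT. Proof. exact: setUCr. Qed.

Fact block_disjoint : [disjoint blockA & blockC].
Proof. by rewrite -setI_eq0 setICr. Qed.

Let class_adj (u v : blockG) x : b (val u) x -> b (val v) x -> u != v -> adj u v.
Proof.
move=> ux vx uv; rewrite /= /induced_adj adj_near val_eqE uv /near.
by rewrite (b_trans ux) ?orbT // b_sym.
Qed.

Fact blockA_clique : clique blockA.
Proof. by move=> u v; rewrite !inE; exact: class_adj. Qed.

Fact blockC_clique : clique blockC.
Proof. by move=> u v /blockCP ux /blockCP; exact: class_adj. Qed.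

Fact block_edge : exists a c, [/\ a \in blockA, c \in blockC & adj a c].
Proof.
have [x_y _] := pairsP (PP i).
have yC : (P i).2 \in comp (P i).1 by apply/compP; rewrite comp2 ?PP.
exists (exist _ (P i).1 (comp_refl _) : blockG), (exist _ (P i).2 yC : blockG).
rewrite !inE /= b_refl b_sym red_b //.
by split=> //; case/andP: x_y.
Qed.

Definition block : augment :=
  Augment block_cover block_disjoint blockA_clique blockC_clique block_edge.

End Block.

(** * Isomorphism with the augmentation *)

Let D := AugmentationData H_flat H_matching block.

(** The isomorphism is built in this direction because both kinds of vertices of the augmentation
    are vertices of [G] with a membership proof. *)
Let back (u : augmented D) : G :=
  match u with
  | inl a => val (val a : kept)
  | inr p => val (tagged p : {x : G | x \in comp (P (tag p)).1})
  end.

Let back_inl (a : {z : line_graph H | z \notin aug_matched D}) :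
  is_clique_comp (val (val a : kept)).
Proof.
case/orP: (valP (val a : kept)) => // /exists_inP[p pP pa].
case/negP: (valP a); rewrite inE; apply/existsP.
exists (enum_rank_in pP p); rewrite -!(inj_eq val_inj) /=.
by rewrite /P enum_rankK_in.
Qed.

Let back_inr (p : aug_block D) : comp (back (inr p)) = comp (P (tag p)).1.
Proof. exact/compP/(valP (tagged p : {x : G | x \in comp (P (tag p)).1})). Qed.

Let origin_comp (p : aug_block D) :
  comp (val (aug_origin p : kept)) = comp (P (tag p)).1.
Proof. by rewrite /aug_origin; case: ifP => _ //=; rewrite comp2 ?PP. Qed.

Let origin_b (p : aug_block D) : b (back (inr p)) (val (aug_origin p : kept)).
Proof.
rewrite /aug_origin; case: ifP => [|/negbT]; first by rewrite inE.
rewrite inE => /negPf zx.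
have [_] := pairsP (PP (tag p)); move/(_ (back (inr p))).
rewrite [b _ (P (tag p)).1]zx; apply.
exact: (valP (tagged p : {x : G | x \in comp (P (tag p)).1})).
Qed.

Let other_comp_adj u v : comp u != comp v -> adj u v = b u v.
Proof.
move=> uv; rewrite adj_near /near.
have -> : red u v = false by apply: contraNF uv => /comp_red ->.
by case: (eqVneq u v) uv => [-> | //]; rewrite eqxx.
Qed.

Let b_origin (p : aug_block D) x : b x (val (aug_origin p : kept)) = b x (back (inr p)).
Proof.
have := origin_b p => bp.
by apply/idP/idP => xp; apply: b_trans xp _; rewrite // b_sym.
Qed.

(** Between components adjacency is [b], and a block vertex has the class of its origin. Inside a
    block adjacency is that of [G]; in a component without a pair all vertices are near each
    other. *)
Let back_adj (u v : augmented D) : adj (back u) (back v) = adj u v.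
Proof.
have mixed a p : adj (back (inl a)) (back (inr p)) =
    adj (val a : line_graph H) (aug_origin p).
  have ap : comp (val (val a : kept)) != comp (P (tag p)).1.
    apply: contraTneq (back_inl a) => ap.
    by rewrite /is_clique_comp ap -/(is_clique_comp _) pairs_not_clique ?PP.
  rewrite H_adj other_comp_adj ?back_inr // origin_comp (negPf ap) /= b_origin.
  suff -> : val (val a : kept) != val (aug_origin p : kept) by [].
  by apply: contraNneq ap => ->; rewrite origin_comp.
case: u v => [a|p] [a'|q].
- rewrite -[RHS]/(adj (val a : line_graph H) (val a')) H_adj [LHS]adj_near.
  congr (_ && _); rewrite /near; have := @near_comp _ (back (inl a')) (back_inl a).
  rewrite /near /=; case: eqP => [/= eqC /(_ eqC) -> // | neqC _ /=].
  by case: (boolP (red _ _)) => // /comp_red.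
- exact: mixed.
- by rewrite adj_sym mixed adj_sym.
rewrite -[RHS]/(aug_adj (inr p) (inr q)) /aug_adj; case: eqP => [|/eqP pq].
  case: p q => [i x] [j y] /= eq_ij; case: _ / eq_ij y => y.
  by rewrite tagged_asE.
have pq' : comp (P (tag p)).1 != comp (P (tag q)).1.
  by apply: contraNneq pq => /P_inj ->.
rewrite H_adj !origin_comp (negPf pq') other_comp_adj ?back_inr //= b_origin b_sym.
rewrite [in RHS]b_sym b_origin.
suff -> : val (aug_origin p : kept) != val (aug_origin q : kept) by [].
by apply: contraNneq pq' => eq_pq; rewrite -!origin_comp eq_pq.
Qed.

Let back_inj : injective back.
Proof.
have cross a p : back (inl a) <> back (inr p).
  move=> ap; have := back_inl a; rewrite -/(back (inl a)) ap /is_clique_comp back_inr.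
  by rewrite -/(is_clique_comp _) pairs_not_clique ?PP.
case=> [a|p] [a'|q] => [/val_inj/val_inj-> // | /cross // | /esym/cross // | pq].
have ij : tag p = tag q by apply: P_inj; rewrite -!back_inr pq.
case: p q pq ij => [i x] [j y] /= xy ij; case: _ / ij y xy => y.
by move/val_inj => ->.
Qed.

Let back_surj v : exists u, back u = v.
Proof.
case clq: (is_clique_comp v).
  have v_kept : is_clique_comp v || is_end v by rewrite clq.
  pose e : line_graph H := exist _ v v_kept : kept.
  have e_unm : e \notin aug_matched D.
    rewrite inE; apply/existsPn => i; apply: contraTN clq.
    rewrite -!(inj_eq val_inj) /= => vi.
    have -> : is_clique_comp v = is_clique_comp (P i).1.
      by case/orP: vi => /eqP->; rewrite // /is_clique_comp comp2 ?PP.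
    by rewrite pairs_not_clique ?PP.
  by exists (inl (exist _ e e_unm)).
have [p pP pv] := pair_of clq.
pose i := enum_rank_in pP p.
have vi : v \in comp (P i).1 by apply/compP; rewrite /P enum_rankK_in.
by exists (inr (Tagged (fun i => block i : finType) (exist _ v vi : block i))).
Qed.

Lemma skew_augmentation_of_splitting :
  exists (H : multigraph) (X Y : {set mvertex H}),
    bipartition X Y /\ skew_augmentation X Y G.
Proof.
pose X : {set mvertex H} := [set x : bool * {set G} | x.1].
exists H, X, (~: X); split; last first.
  exists D; split.
    (* The two edges of a pair meet at the vertex of [H] given by their component, which lies in
       [X]. *)
    left=> i; exists (true, comp (P i).1).
    by rewrite /= /kept_ends !inE /= comp2 ?PP // !eqxx.
  have [f fK bK] := inj_surj_bij back_inj back_surj.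
  by exists f; split=> [|u v]; [exists back | rewrite -back_adj !bK].
split; [exact: setUCr | by rewrite -setI_eq0 setICr | move=> e; split].
  apply/eqP/cards1P; exists (true, comp (val (e : kept))); apply/setP=> -[[] C];
    by rewrite /= /kept_ends !inE !xpair_eqE /= ?andbF ?orbF ?andbT.
apply/eqP/cards1P; exists (false, class (val (e : kept))); apply/setP=> -[[] C];
  by rewrite /= /kept_ends !inE !xpair_eqE /= ?andbF ?orbF ?andbT.
Qed.

End Decomposition.

(* [s] is the endpoint on the side of the augmentation and [t] the other one. *)
Lemma bipartite_line_labels (H : multigraph) (S T : {set mvertex H}) :
    [disjoint S & T] ->
    (forall e : medge H, #|mends e :&: S| = 1 /\ #|mends e :&: T| = 1) ->
  exists s t : medge H -> mvertex H,
    [/\ forall e v, v \in S -> v \in mends e -> s e = v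
      & forall e f : line_graph H,
          adj e f = (e != f) && ((s e == s f) || (t e == t f))].
Proof.
move=> ST card1.
have label (U : {set mvertex H}) : (forall e : medge H, #|mends e :&: U| = 1) ->
    exists r : medge H -> mvertex H, forall e, mends e :&: U = [set r e].
  move=> cardU; have ex_r e : exists v, mends e :&: U == [set v].
    by have /eqP/cards1P[v eU] := cardU e; exists v; apply/eqP.
  by exists (fun e => xchoose (ex_r e)) => e; apply/eqP/(xchooseP (ex_r e)).
have [s sE] := label S (fun e => (card1 e).1).
have [t tE] := label T (fun e => (card1 e).2).
have s_in e : (s e \in mends e) && (s e \in S) by rewrite -in_setI sE set11.
have t_in e : (t e \in mends e) && (t e \in T) by rewrite -in_setI tE set11.
have endsE e : mends e = [set s e; t e].
  apply/esym/eqP; rewrite eqEcard mends_card cards2.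
  have /andP[se sS] := s_in e; have /andP[te tT] := t_in e.
  rewrite subUset !sub1set se te; case: eqP => // est.
  by have /pred0P/(_ (s e)) := ST; rewrite /= sS est tT.
exists s, t; split=> [e v vS ve | e f].
  by apply/esym/set1P; rewrite -sE inE ve.
have st e' f' : s e' == t f' = false.
  have /andP[_ sS] := s_in e'; have /andP[_ tT] := t_in f'.
  by apply: contraTF tT => /eqP <-; have /pred0P/(_ (s e')) := ST; rewrite /= sS /= => ->.
rewrite /= /line_adj; congr (_ && _); apply/set0Pn/orP => [[v] | [/eqP ef | /eqP ef]].
- rewrite !endsE !inE => /andP[/orP[]/eqP->];
    rewrite ?[t e == s f]eq_sym !st ?orbF //= => ->;
    by [left | right].
- by exists (s e); rewrite !endsE !inE ef eqxx.
- by exists (t e); rewrite !endsE !inE ef eqxx !orbT.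
Qed.

(** * Splitting an augmentation *)

Section Augmented.
Variables (G0 : sgraph) (D : augmentation_data G0) (L M : eqType).
Variables (s : G0 -> L) (t : G0 -> M).
Hypothesis adjE : forall e f, adj e f = (e != f) && ((s e == s f) || (t e == t f)).
Hypothesis sxy : forall i, s (aug_x D i) = s (aug_y D i).

(** A third edge at the common [s]-end would form a triangle with the flat pair. *)
Let pair_adj i e : s e = s (aug_x D i) -> (e == aug_x D i) || (e == aug_y D i).
Proof.
have [_ /(_ e)] := aug_flat (a := D) i; rewrite !adjE -sxy => /negP noT se.
apply: contraT; rewrite negb_or => /andP[ex ey]; case: noT.
by rewrite eq_sym ex [_ == e]eq_sym ey se eqxx.
Qed.

(* A flat pair may consist of parallel edges, which [t] does not tell apart;
   such a pair is a component of the graph, so it can be relabelled freely. *)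
Let parallel (e : G0) :=
  [exists i, (t (aug_x D i) == t (aug_y D i)) && ((e == aug_x D i) || (e == aug_y D i))].

Let t' (e : G0) : M + G0 := if parallel e then inr e else inl (t e).

(** Parallel edges have the same other neighbours, so by flatness they have none: [f] belongs to the
    pair of [e]. *)
Let parallel_adj e f : parallel e -> adj e f -> s e = s f.
Proof.
case/existsP=> i /andP[/eqP txy e_xy].
have [_ /(_ f)] := aug_flat (a := D) i; rewrite !adjE -!sxy -!txy => /negP noT.
have se : s e = s (aug_x D i) by case/orP: e_xy => /eqP ->.
have te : t e = t (aug_x D i) by case/orP: e_xy => /eqP ->.
rewrite se te; case/andP=> _ adj_f; rewrite adj_f !andbT in noT.
have : (f == aug_x D i) || (f == aug_y D i).
  apply: contraT; rewrite negb_or => /andP[fx fy]; case: noT.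
  by rewrite eq_sym fx eq_sym fy.
by case/orP => /eqP ->; rewrite -?sxy.
Qed.

(** Relabelling loses no adjacency, as a parallel edge is adjacent only along [s], and creates none,
    as its new label is its own. *)
Let adjE' e f : adj e f = (e != f) && ((s e == s f) || (t' e == t' f)).
Proof.
apply/idP/andP => [ef | [ef st]].
  split; first by apply: contraTneq ef => ->; rewrite adj_irr.
  rewrite /t'; case: ifP => [/parallel_adj/(_ ef) -> | _]; first by rewrite eqxx.
  have fe : adj f e by rewrite adj_sym.
  case: ifP => [/parallel_adj/(_ fe) -> | _]; first by rewrite eqxx.
  by move: ef; rewrite adjE => /andP[].
rewrite adjE ef; case/orP: st => [-> // | ]; rewrite /t'.
case: ifP => _; case: ifP => _ /eqP // [eq_ef]; last by rewrite eq_ef eqxx orbT.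
by rewrite eq_ef eqxx in ef.
Qed.

(** This puts the two cliques of an augment in different classes, so that vertices of one block with
    equal labels are in one clique. *)
Let txy' i : t' (aug_x D i) != t' (aug_y D i).
Proof.
have [xy _] := aug_flat (a := D) i.
have neq_xy : aug_x D i != aug_y D i by apply: contraTneq xy => ->; rewrite adj_irr.
rewrite /t'; case: ifP => [_ | /negbT/existsPn/(_ i) txy].
  by case: ifP => // _; apply: contra neq_xy => /eqP[->].
by rewrite eqxx andbT in txy; case: ifP.
Qed.

Let origin (u : augmented D) : G0 :=
  match u with inl a => val a | inr p => aug_origin p end.

Let origin_pair p :
  (aug_origin p == aug_x D (tag p)) || (aug_origin p == aug_y D (tag p)).
Proof. by rewrite /aug_origin; case: ifP; rewrite eqxx ?orbT. Qed.

Let s_origin p : s (aug_origin p) = s (aug_x D (tag p)).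
Proof. by case/orP: (origin_pair p) => /eqP ->; rewrite -?sxy. Qed.

Let inl_origin (a : {z : G0 | z \notin aug_matched D}) (p : aug_block D) :
  val a != aug_origin p.
Proof.
apply: contraNneq (valP a) => ->; rewrite inE.
by apply/existsP; exists (tag p); exact: origin_pair.
Qed.

Let inr_origin (p q : aug_block D) : tag p != tag q -> aug_origin p != aug_origin q.
Proof.
move/(aug_matching (a := D))/pred0P/(_ (aug_origin p)) => /=.
rewrite !inE origin_pair /=; apply: contraFneq => ->; exact: origin_pair.
Qed.

Let b (u v : augmented D) := t' (origin u) == t' (origin v).

Let b_adj u v : b u v -> u != v -> adj u v.
Proof.
have adj_t e f : t' e == t' f -> e != f -> adj e f.
  by move=> te ef; rewrite adjE' ef te orbT.
rewrite /b; case: u v => [a|p] [a'|q] /= tt' uv.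
- exact: adj_t.
- exact/adj_t/inl_origin.
- by apply: adj_t; rewrite // eq_sym inl_origin.
rewrite /aug_adj; case: eqP => [|/eqP pq]; last exact/adj_t/inr_origin.
case: p q tt' uv => [i x] [j y] /= tt' uv ij; case: _ / ij y tt' uv => y tt' uv.
rewrite tagged_asE; have {}uv : x != y by apply: contraNneq uv => ->.
have xAC z : (z \in augA (aug_B D i)) || (z \in augC (aug_B D i)).
  by rewrite -in_setU augAC_cover inE.
move: tt' (xAC x) (xAC y); rewrite /aug_origin /=.
case: ifP => xA; case: ifP => yA;
  rewrite ?[_ == t' (aug_x D i)]eq_sym ?(negPf (txy' i)) //= => _.
  by move=> _ _; apply: augA_clique.
by move=> xC yC; apply: (augC_clique xC yC).
Qed.

(** Adjacent origins with different [t'] must agree on [s]; within one block both origins belong to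
    the same pair, whose edges share [s]. *)
Let crossing_s u v : crossing b u v -> s (origin u) = s (origin v).
Proof.
have adj_s e f : adj e f -> t' e != t' f -> s e = s f.
  by rewrite adjE' => /andP[_ /orP[/eqP // | ->]].
rewrite /crossing /b; case: u v => [a|p] [a'|q] /= /andP[uv tt'].
- exact: adj_s.
- exact: adj_s.
- exact: adj_s.
move: uv; rewrite /aug_adj; case: eqP => [pq _ | _ /adj_s -> //].
by rewrite !s_origin pq.
Qed.

Lemma augmented_splitting : exists b : rel (augmented D), clique_splitting b.
Proof.
exists b; split=> [u | u v | v u w | | u v w uv vw uw].
- exact: eqxx.
- by rewrite /b eq_sym.
- by rewrite /b => /eqP-> /eqP->.
- exact: b_adj.
case: (boolP (b u w)) => [/b_adj -> // | ntuw].
have suv := crossing_s uv; have svw := crossing_s vw.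
have /andP[_ ntuv] := uv; have /andP[_ ntvw] := vw.
(* Three distinct edges with the same [s]-end: none of them is in a pair. *)
have unmatched p : inr p \in [:: u; v; w] -> False.
  have in_pair z : z \in [:: u; v; w] -> s (origin z) = s (origin u).
    by rewrite !inE => /or3P[]/eqP->; rewrite // -svw.
  move/in_pair; rewrite /= s_origin => sp.
  move: ntuv ntvw ntuw; rewrite /b.
  have /pair_adj/orP[] := esym sp; have /pair_adj/orP[] := esym (etrans sp suv);
  have /pair_adj/orP[] := esym (etrans sp (etrans suv svw));
  by move=> /eqP-> /eqP-> /eqP->; rewrite eqxx.
case: u w {uv vw} uw suv ntuv ntvw ntuw unmatched svw => [a|p] [a'|q].
- move=> uw suv _ _ _ _ svw /=; rewrite adjE' uw.
  by move: suv svw => /= -> ->; rewrite eqxx.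
- by move=> _ _ _ _ _ /(_ q); rewrite !inE eqxx !orbT => /(_ isT).
- by move=> _ _ _ _ _ /(_ p); rewrite !inE eqxx => /(_ isT).
- by move=> _ _ _ _ _ /(_ p); rewrite !inE eqxx => /(_ isT).
Qed.

End Augmented.

Lemma splitting_of_skew_augmentation (G : sgraph) (H : multigraph)
    (X Y : {set mvertex H}) :
  bipartition X Y -> skew_augmentation X Y G ->
  exists b : rel G, clique_splitting b.
Proof.
move=> [_ XY card1] [D [side_D [f [f_bij f_adj]]]].
(* [X] and [Y] are exchanged if necessary, so that [S] is the side of the augmentation. *)
have [S [T [ST card1' side_S]]] : exists S T : {set mvertex H}, [/\ [disjoint S & T],
    forall e : medge H, #|mends e :&: S| = 1 /\ #|mends e :&: T| = 1
    & side_augmentation S D].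
  case: side_D => [sX | sY]; [by exists X, Y | exists Y, X; split=> // [|e]].
    by rewrite disjoint_sym.
  by have [] := card1 e.
have [s [t [sE adjE]]] := bipartite_line_labels ST card1'.
have [|b [b_refl b_sym b_trans b_adj x_adj]] := augmented_splitting (D := D) adjE.
  by move=> i; have [v [vS vx vy]] := side_S i; rewrite !(sE _ v).
have f_neq u v : u != v -> f u != f v by rewrite (bij_eq f_bij).
exists (fun u v => b (f u) (f v)); split=> [u | u v | v u w | u v uv /f_neq | u v w].
- exact: b_refl.
- exact: b_sym.
- exact: b_trans.
- by rewrite -f_adj; exact: b_adj.
rewrite /crossing -!f_adj => uv vw /f_neq; exact: x_adj uv vw.
Qed.

Theorem theorem23 (G : sgraph) :
  (admits_free (fun P => [\/ P = rP3, P = bP3 | P = rrbK3]) G <->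
   admits_free (fun P => [\/ P = rP3, P = bP3 | P = rbbK3]) G)
  /\
  (admits_free (fun P => [\/ P = rP3, P = bP3 | P = rbbK3]) G <->
   exists (H : multigraph) (X Y : {set mvertex H}),
     bipartition X Y /\ skew_augmentation X Y G).
Proof.
have isRB : Red <> Blue by [].
have isBR : Blue <> Red by [].
have rrb := @admits_freeP G Red Blue isRB.
have rbb := @admits_freeP G Blue Red isBR.
split; first exact: iff_trans rrb (iff_sym rbb).
apply: iff_trans rbb _; split=> [[b] | [H [X [Y [XY]]]]].
  exact: skew_augmentation_of_splitting.
exact: splitting_of_skew_augmentation.
Qed.
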